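(* Let $\alpha\in(0,1)$ be an irrational number and let $(q_n)$ be the sequence of denominators of the convergents of the regular continued fraction of $\alpha$. Then the subgroup $t^s_{(q_n)}(\mathbb{T})$ of $\mathbb{T}$ is uncountable.
   Context: $\mathbb{T}=\mathbb{R}/\mathbb{Z}$ is the circle group, and for $x\in\mathbb{T}$, $\|x\|$ denotes the distance of (any representative of) $x$ to the nearest integer. The regular continued fraction of an irrational $\alpha\in(0,1)$ is written $\alpha=[0;a_1,a_2,\dots]$ with convergents $\frac{p_n}{q_n}=[0;a_1,\dots,a_n]$ in lowest terms, $q_n>0$. For $A\subset\mathbb{N}$, the natural density is $d(A)=\lim_{n\to\infty}\frac{|A\cap[1,n]|}{n}$ when this limit exists. For a sequence of integers $(u_n)$, the statistically characterized subgroup is $$t^s_{(u_n)}(\mathbb{T})=\{x\in\mathbb{T}: u_nx\to 0 \text{ statistically}\}=\{x\in\mathbb{T}: \forall\varepsilon>0,\ d(\{n\in\mathbb{N}:\|u_nx\|\ge\varepsilon\})=0\}.$$ *)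

(* Defs.v *)
(* MathComp-Analysis *)
From HB Require Import structures.
From mathcomp Require Import all_boot all_order all_algebra.
From mathcomp Require Import ring_quotient generic_quotient.
From mathcomp Require Import all_classical all_reals all_analysis.
Import Order.TTheory GRing.Theory Num.Theory numFieldNormedType.Exports.

Set Implicit Arguments.
Unset Strict Implicit.
Unset Printing Implicit Defensive.

Local Open Scope classical_set_scope.
Local Open Scope ring_scope.

Definition int_subgroup (R : realType) : zmodClosed R :=
  GRing.ZmodClosed.clone R (@Num.int_num_subdef R) _.

(* The circle group R/Z, with its canonical zmodType structure. *)
Notation circle R := (Quotient.quot (int_subgroup R)).

Definition dist_int {R : realType} (r : R) : R :=
  inf [set `|r - m%:~R| | m in [set: int]].

(* Independent of the chosen representative, see circle_norm_pi. *)
Definition circle_norm {R : realType} (x : circle R) : R := dist_int (repr x).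

(* The positive integers are {1, 2, ...}: the index 0 is never
   counted. *)
Definition density_upto {R : realType} (A : set nat) (n : nat) : R :=
  (count (fun k => k \in A) (iota 1 n))%:R / n%:R.

Definition has_density {R : realType} (A : set nat) (d : R) : Prop :=
  density_upto A @ \oo --> d.

Definition stat_cvg0 {R : realType} (v : nat -> circle R) : Prop :=
  forall eps : R, 0 < eps ->
    has_density [set n | eps <= circle_norm (v n)] (0 : R).

Definition stat_char_subgroup {R : realType} (u : nat -> int) :
    set (circle R) :=
  [set x | stat_cvg0 (fun n => x *~ u n)].

Definition gauss_map {R : realType} (x : R) : R :=
  x^-1 - (Num.floor x^-1)%:~R.

(* [cf_digit alpha n] is the partial quotient a_(n+1) of an irrational
   alpha in (0,1). *)
Definition cf_digit {R : realType} (alpha : R) (n : nat) : int :=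
  Num.floor (iter n gauss_map alpha)^-1.

(* [0; a_1, ..., a_n] as a rational number; [0;] = 0, so q_0 = 1. *)
Definition convergent {R : realType} (alpha : R) (n : nat) : rat :=
  foldr (fun (a : int) (x : rat) => (a%:~R + x)^-1) 0
        (mkseq (cf_digit alpha) n).

Definition cf_denom {R : realType} (alpha : R) (n : nat) : int :=
  denq (convergent alpha n).

Section Sanity.
Context {R : realType}.
Implicit Types (r s : R) (x y : circle R).

Lemma dist_int_lb r : has_lbound [set `|r - m%:~R| | m in [set: int]].
Proof. by exists 0 => _ [m _ <-]. Qed.

Lemma dist_int_ge0 r : 0 <= dist_int r.
Proof.
by apply: lb_le_inf; [exists `|r - 0%:~R|, 0 | move=> _ [m _ <-]].
Qed.

Lemma dist_int_le r (m : int) : dist_int r <= `|r - m%:~R|.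
Proof. by apply: ge_inf; [exact: dist_int_lb | exists m]. Qed.

Lemma dist_intDz r (k : int) : dist_int (r + k%:~R) = dist_int r.
Proof.
congr inf; apply/seteqP; split=> _ [m _ <-].
  by exists (m - k) => //; rewrite intrB opprB addrA.
by exists (m + k) => //; rewrite intrD opprD addrACA subrr addr0.
Qed.

Lemma circle_norm_pi r : circle_norm (\pi_(circle R)%qT r) = dist_int r.
Proof.
rewrite /circle_norm; set s := repr _.
have : s - r \is a Num.int.
  by rewrite Quotient.idealrBE reprK.
move=> /intrP[k sr]; have -> : s = r + k%:~R by rewrite -sr addrC subrK.
exact: dist_intDz.
Qed.

Lemma circle_normB x y : circle_norm (x - y) <= circle_norm x + circle_norm y.
Proof.
rewrite -[x]reprK -[y]reprK -raddfB !circle_norm_pi.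
set r := repr x; set s := repr y.
rewrite -lerBlDr; apply: lb_le_inf; first by exists `|r - 0%:~R|, 0.
move=> _ [m _ <-]; rewrite lerBlDr -lerBlDl.
apply: lb_le_inf; first by exists `|s - 0%:~R|, 0.
move=> _ [k _ <-]; rewrite lerBlDl.
apply: (le_trans (dist_int_le _ (m - k))).
suff -> : r - s - (m - k)%:~R = (r - m%:~R) - (s - k%:~R) by exact: ler_normB.
by rewrite intrB !opprB addrACA [RHS]addrACA [- s + _]addrC.
Qed.

Lemma circle_norm0 : circle_norm (0 : circle R) = 0.
Proof.
rewrite -[0](raddf0 (\pi_(circle R)%qT)) circle_norm_pi.
apply/eqP; rewrite eq_le dist_int_ge0 andbT.
by have := dist_int_le 0 0; rewrite subrr normr0.
Qed.

Lemma has_density0_sub (A B C : set nat) : A `<=` B `|` C ->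
  has_density B (0 : R) -> has_density C (0 : R) -> has_density A (0 : R).
Proof.
move=> sABC dB dC.
have dBC : (fun n => density_upto B n + density_upto C n : R) @ \oo --> (0 : R).
  by rewrite -[X in _ --> X]addr0; exact: cvgD.
apply: (@squeeze_cvgr _ _ _ _ (cst 0) _ _ _ _ _ dBC); last exact: cvg_cst.
near=> n; apply/andP; split; first by rewrite divr_ge0.
rewrite /density_upto -mulrDl ler_wpM2r ?invr_ge0// -natrD ler_nat.
rewrite -count_predUI; apply: leq_trans (leq_addr _ _).
by apply: sub_count => k /= /set_mem/sABC[] /mem_set -> //; rewrite orbT.
Unshelve. all: by end_near. Qed.

Lemma stat_char_subgroup_closed (u : nat -> int) :
  stat_char_subgroup u (0 : circle R) /\
  (forall x y, stat_char_subgroup u x -> stat_char_subgroup u y ->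
     stat_char_subgroup u (x - y)).
Proof.
split=> [eps eps0|x y tx ty eps eps0].
  rewrite (_ : [set _ | _] = set0); last first.
    apply/seteqP; split=> n //=.
    by rewrite mul0rz circle_norm0 leNgt eps0.
  apply: (@cvg_trans _ ((fun=> 0 : R) @ \oo)); last exact: cvg_cst.
  apply: near_eq_cvg; near=> n.
  by rewrite /density_upto (@eq_count _ _ pred0) ?count_pred0 ?mul0r// => k; rewrite in_set0.
have e2 : 0 < eps / 2 by rewrite divr_gt0.
apply: has_density0_sub (tx _ e2) (ty _ e2) => n /= le_eps.
have [|lt_x] := leP (eps / 2) (circle_norm (x *~ u n)); first by left.
right=> /=; rewrite leNgt; apply/negP => lt_y.
have := le_lt_trans (circle_normB _ _) (ltrD lt_x lt_y).
by rewrite -mulrzBl -splitr ltNge le_eps.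
Unshelve. all: by end_near. Qed.

End Sanity.

(* Main.v *)
(* Write theta_m = |q_m alpha - p_m|. Both q_n theta_m and q_m theta_n are
   integer combinations of 1 and alpha, and up to sign they differ by an
   integer; since q_n theta_n <= 1 and theta_(n+2) <= theta_n / 2, the distance
   from q_n theta_m to the nearest integer is at most a constant times
   2^(-|n - m|/2). Choosing m in a set of squares, a sum x of theta_m over any
   subset of the squares satisfies ||q_n x|| = O(2^(-M/2)) whenever n is at
   distance at least M from the squares, that is, for n in a set of density 1.
   As theta_m decreases fast along the squares, distinct subsets give distinct
   points of [0, 1/2], so there are uncountably many such x. *)

Require Import Defs.
From mathcomp Require Import all_boot all_order all_algebra.
From mathcomp Require Import all_classical all_reals all_analysis.
From mathcomp Require Import zify ring lra.
Import Order.TTheory GRing.Theory Num.Theory numFieldNormedType.Exports.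
Local Open Scope classical_set_scope.
Local Open Scope ring_scope.

(** * Numerators and denominators of convergents *)

Fixpoint cf_rec (a : nat -> int) (x0 x1 : int) (n : nat) : int :=
  match n with
  | 0 => x0
  | m.+1 => match m with
            | 0 => x1
            | k.+1 => a k * cf_rec a x0 x1 m + cf_rec a x0 x1 k
            end
  end.

(* Indices are shifted by one: [cf_num a n.+1] and [cf_den a n.+1] are the
   usual p_n and q_n, and index 0 is the formal convergent 1/0. *)
Definition cf_num a := cf_rec a 1 0.
Definition cf_den a := cf_rec a 0 1.

Lemma cf_numSS a n : cf_num a n.+2 = a n * cf_num a n.+1 + cf_num a n.
Proof. by []. Qed.

Lemma cf_denSS a n : cf_den a n.+2 = a n * cf_den a n.+1 + cf_den a n.
Proof. by []. Qed.

Section PositiveDigits.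
Context (a : nat -> int).
Context (a_ge1 : forall n, 1 <= a n).

Lemma cf_den_ge01 n : 0 <= cf_den a n /\ 1 <= cf_den a n.+1.
Proof.
elim: n => [//|n [q0 q1]]; rewrite cf_denSS; split; first by lia.
by have := a_ge1 n; nia.
Qed.

Lemma cf_den_ge0 n : 0 <= cf_den a n.
Proof. by have [] := cf_den_ge01 n. Qed.

Lemma cf_denS_ge1 n : 1 <= cf_den a n.+1.
Proof. by have [] := cf_den_ge01 n. Qed.

Lemma cf_den_leS n : cf_den a n <= cf_den a n.+1.
Proof.
case: n => [//|n]; rewrite cf_denSS.
by have := a_ge1 n; have := cf_den_ge0 n; have := cf_denS_ge1 n; nia.
Qed.

Lemma cf_den_double n : 2 * cf_den a n <= cf_den a n.+2.
Proof.
rewrite cf_denSS; have := cf_den_leS n; have := a_ge1 n.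
by have := cf_den_ge0 n; nia.
Qed.

Lemma cf_det n :
  cf_num a n * cf_den a n.+1 - cf_num a n.+1 * cf_den a n = (-1) ^+ n.
Proof.
by elim: n => [//|n IH]; rewrite cf_numSS cf_denSS exprS -IH; ring.
Qed.

Lemma cf_coprime n : coprimez (cf_num a n) (cf_den a n).
Proof.
(* Multiplied by its own sign, [cf_det] becomes a Bezout relation. *)
apply/coprimezP; exists ((-1) ^+ n * cf_den a n.+1, - (-1) ^+ n * cf_num a n.+1).
rewrite /= (_ : _ + _ = (-1) ^+ n * (cf_num a n * cf_den a n.+1 -
  cf_num a n.+1 * cf_den a n)); last by ring.
by rewrite cf_det -expr2 sqrr_sign.
Qed.

(** The free tail [x] lets the induction strip the last digit, which is absorbed into the new tail
    [((a n)%:~R + x)^-1]; convergents are the case [x = 0]. *)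
Lemma foldr_cfE n (x : rat) : 0 <= x ->
  foldr (fun (b : int) (y : rat) => (b%:~R + y)^-1) x (mkseq a n) =
  (x * (cf_num a n)%:~R + (cf_num a n.+1)%:~R) /
  (x * (cf_den a n)%:~R + (cf_den a n.+1)%:~R).
Proof.
elim: n x => [|n IH] x x0.
  by rewrite /= mulr1 mulr0 addr0 add0r divr1.
have ax : 0 < (a n)%:~R + x :> rat.
  by rewrite ltr_wpDr// ltr0z (lt_le_trans _ (a_ge1 n)).
rewrite mkseqS foldr_rcons IH ?invr_ge0 ?ltW// cf_numSS cf_denSS.
have q0 : 0 <= (cf_den a n)%:~R :> rat by rewrite ler0z cf_den_ge0.
have q1 : 1 <= (cf_den a n.+1)%:~R :> rat by rewrite (ler_int _ 1) cf_denS_ge1.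
rewrite !intrD !intrM; field; apply/andP; split; last by rewrite gt_eqF.
by rewrite !gt_eqF//; nra.
Qed.
End PositiveDigits.

Lemma cf_denomE (R : realType) (alpha : R) n :
  (forall n, 1 <= cf_digit alpha n) ->
  cf_denom alpha n = cf_den (cf_digit alpha) n.+1.
Proof.
move=> a_ge1; rewrite /cf_denom /convergent foldr_cfE// !mul0r !add0r.
rewrite coprimeq_den; last exact: cf_coprime.
by have := cf_denS_ge1 _ a_ge1 n; case: eqP => [->//|_]; lia.
Qed.

(** * Gauss map and approximation errors *)

Section GaussOrbit.
Context {R : realType} (alpha : R).
Context (alpha01 : 0 < alpha < 1).
Context (alpha_irr : irrational alpha).

Let T n : R := iter n gauss_map alpha.
Let a := cf_digit alpha.
Let Q n : R := (cf_den a n)%:~R.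
Let P n : R := (cf_num a n)%:~R.

(** Irrationality is carried through the induction because it keeps the orbit away from 0. *)
Lemma gauss_iter n : 0 < T n < 1 /\ irrational (T n).
Proof.
elim: n => [//|n [T01 Tirr]].
have TSirr : irrational (T n.+1).
  move=> [q _ qE]; apply: Tirr.
  exists ((q + (Num.floor (T n)^-1)%:~R)^-1) => //.
  by rewrite fmorphV rmorphD/= ratr_int qE /= /gauss_map subrK invrK.
split=> //; have /andP[fl fu] := floor_itv (T n)^-1.
rewrite lt_neqAle; apply/andP; split; last first.
  by rewrite /T /= /gauss_map ltrBlDl -[X in _ + X]/(1%:~R) -intrD.
apply/andP; split; last by rewrite /T /= /gauss_map subr_ge0.
by apply/eqP => E; apply: TSirr; exists 0 => //; rewrite rmorph0.
Qed.

Lemma cf_digit_ge1 n : 1 <= a n.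
Proof.
have [/andP[T0 T1] _] := gauss_iter n.
by rewrite /a /cf_digit floor_ge_int invf_ge1 // ltW.
Qed.

(* The distance |q_(n-1) alpha - p_(n-1)|, see cf_errE. *)
Definition cf_err n : R := \prod_(i < n) iter i gauss_map alpha.

Local Notation D := cf_err.

Lemma cf_err0 : D 0%N = 1. Proof. by rewrite /D big_ord0. Qed.

Lemma cf_errS n : D n.+1 = D n * T n.
Proof. by rewrite /D big_ord_recr. Qed.

Lemma cf_err_gt0 n : 0 < D n.
Proof.
by apply: prodr_gt0 => i _; have [/andP[]] := gauss_iter i.
Qed.

Lemma cf_err_leS n : D n.+1 <= D n.
Proof.
by rewrite cf_errS ler_piMr ?ltW ?cf_err_gt0//; have [/andP[]] := gauss_iter n.
Qed.

(** This is [(T n)^-1 = (a n)%:~R + T n.+1] multiplied by [D n.+1]. *)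
Lemma cf_err_rec n : D n = (a n)%:~R * D n.+1 + D n.+2.
Proof.
have [/andP[T0 _] _] := gauss_iter n.
rewrite !cf_errS /a /cf_digit -/(T n) [T n.+1]/(gauss_map (T n)) /gauss_map.
by field; rewrite gt_eqF.
Qed.

Lemma cf_err_half n : D n.+2 <= D n / 2.
Proof.
rewrite (cf_err_rec n).
have a1 : 1 <= (a n)%:~R :> R by rewrite (ler_int _ 1) cf_digit_ge1.
by have := cf_err_gt0 n.+1; have := cf_err_leS n.+1; nra.
Qed.

Lemma cf_errE n : D n = (-1) ^+ n * (P n - Q n * alpha).
Proof.
(* The recurrence has order two, so two consecutive indices go through the induction together. *)
suff [] : D n = (-1) ^+ n * (P n - Q n * alpha) /\
          D n.+1 = (-1) ^+ n.+1 * (P n.+1 - Q n.+1 * alpha) by [].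
elim: n => [|n [IH1 IH2]].
  by rewrite cf_errS cf_err0 /P /Q /T /=; split; ring.
split=> //; have := cf_err_rec n; rewrite IH1 IH2 => E.
have -> : D n.+2 = (-1) ^+ n * (P n - Q n * alpha) -
    (a n)%:~R * ((-1) ^+ n.+1 * (P n.+1 - Q n.+1 * alpha)) by rewrite E; ring.
by rewrite /P /Q cf_numSS cf_denSS !intrD !intrM !exprS; ring.
Qed.

(** The recurrences of [Q] and [D] make the left side independent of [n]. *)
Lemma cf_den_err n : Q n.+1 * D n + Q n * D n.+1 = 1.
Proof.
elim: n => [|n IH]; first by rewrite cf_err0 /Q /=; ring.
rewrite -[RHS]IH (cf_err_rec n) /Q cf_denSS intrD intrM; ring.
Qed.

Lemma cf_den_err_le1 n : Q n * D n <= 1.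
Proof.
have Qge0 k : 0 <= Q k by rewrite ler0z cf_den_ge0//; exact: cf_digit_ge1.
have Dge0 k : 0 <= D k by rewrite ltW ?cf_err_gt0.
rewrite -(cf_den_err n) ler_wpDr ?mulr_ge0// ler_wpM2r// ler_int cf_den_leS//.
exact: cf_digit_ge1.
Qed.

Lemma cf_err_decay n k : D (n + k) <= D n * 2^-1 ^+ k./2.
Proof.
have [m] := ubnP k; elim: m k => // m IH [|[|k]] km; rewrite ?addn0 ?mulr1//.
  by rewrite addn1 cf_err_leS.
rewrite !addnS /= exprS mulrCA; apply: le_trans (cf_err_half _) _.
by rewrite mulrC ler_wpM2l ?invr_ge0 ?IH//; lia.
Qed.

(* Expanding both errors by cf_errE, the terms in alpha cancel. *)
Lemma cf_den_err_swap n m :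
  exists z : int, Q n * D m = (-1) ^+ (n + m) * (Q m * D n) + z%:~R.
Proof.
exists ((-1) ^+ m * (cf_den a n * cf_num a m - cf_den a m * cf_num a n)).
rewrite !cf_errE exprD intrM intrB !intrM rmorphXn /= intrN.
have s2 : (-1) ^+ n * (-1) ^+ n = 1 :> R by rewrite -expr2 sqrr_sign.
rewrite -/(P _) -/(P _) -/(Q _) -/(Q _).
transitivity ((-1) ^+ m * Q m * ((-1) ^+ n * (-1) ^+ n) * (P n - Q n * alpha) +
  (-1) ^+ m * (Q n * P m - Q m * P n)); last by ring.
by rewrite s2; ring.
Qed.
End GaussOrbit.

(** * Subset sums of a fast decreasing sequence *)

Section LacunarySum.
Context {R : realType} (d : nat -> R) (s : nat -> bool).
Context (d_gt0 : forall j, 0 < d j).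
Context (d_half : forall j, d j.+1 <= d j / 2).

Let psum k : R := \sum_(j < k) (s j)%:R * d j.

(** The value of the series: its partial sums are nondecreasing when [d] is positive. *)
Definition lacunary_sum : R := sup (range (fun k => \sum_(j < k) (s j)%:R * d j)).

Lemma psumS_le k : psum k <= psum k.+1 <= psum k + d k.
Proof.
rewrite /psum big_ord_recr /= lerDl lerD2l.
by have := d_gt0 k; case: (s k) => /=; lra.
Qed.

(* d_k <= 2 (d_k - d_(k+1)) makes the upper bound telescope. *)
Lemma psumD_le k l : psum k <= psum (k + l) <= psum k + 2 * (d k - d (k + l)%N).
Proof.
elim: l => [|l /andP[IH1 IH2]]; first by rewrite addn0 subrr mulr0 addr0 lexx.
have /andP[] := psumS_le (k + l); have := d_half (k + l); rewrite addnS.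
by move=> *; apply/andP; split; lra.
Qed.

Lemma psum_ub k : ubound (range psum) (psum k + 2 * d k).
Proof.
move=> _ [l _ <-]; have [kl|/ltnW lk] := leqP k l.
  have /andP[_] := psumD_le k (l - k); rewrite subnKC//.
  by have := d_gt0 l; lra.
have /andP[+ _] := psumD_le l (k - l); rewrite subnKC//.
by have := d_gt0 k; lra.
Qed.

Lemma lacunary_sum_itv k : psum k <= lacunary_sum <= psum k + 2 * d k.
Proof.
apply/andP; split.
  by apply: ub_le_sup; [exists (psum k + 2 * d k); exact: psum_ub | exists k].
by apply: ge_sup; [exists (psum 0), 0%N | exact: psum_ub].
Qed.
End LacunarySum.

(** At the first difference [s] gains [d k], while the later terms of [t] add at most
    [2 * d k.+1 <= d k / 2]. A ratio of 1/2 would lose strictness in this estimate. *)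
Lemma lacunary_sum_lt (R : realType) (d : nat -> R) (s t : nat -> bool) k :
  (forall j, 0 < d j) -> (forall j, d j.+1 <= d j / 4) ->
  (forall j, (j < k)%N -> s j = t j) -> s k -> ~~ t k ->
  lacunary_sum d t < lacunary_sum d s.
Proof.
move=> d0 d4 st sk /negbTE tk.
have d2 j : d j.+1 <= d j / 2 by have := d4 j; have := d0 j; lra.
have /andP[lo _] := lacunary_sum_itv d s d0 d2 k.+1.
have /andP[_ hi] := lacunary_sum_itv d t d0 d2 k.+1.
apply: le_lt_trans hi (lt_le_trans _ lo).
rewrite !big_ord_recr /= sk tk mul0r mul1r addr0.
under [X in _ < X + _]eq_bigr => j _ do rewrite st//.
by rewrite ltrD2l; have := d4 k; have := d0 k; lra.
Qed.

Lemma lacunary_sum_inj (R : realType) (d : nat -> R) :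
  (forall j, 0 < d j) -> (forall j, d j.+1 <= d j / 4) ->
  injective (lacunary_sum d).
Proof.
move=> d0 d4 s t E; apply/funext => k; apply/eqP.
have [k'] := ubnP k; elim: k' k => // k' IH k kk'.
have st j : (j < k)%N -> s j = t j by move=> jk; apply/eqP/IH; lia.
case sk: (s k); case tk: (t k) => //; exfalso.
  by have := lacunary_sum_lt _ d s t k d0 d4 st sk (negbT tk); rewrite E ltxx.
have ts j : (j < k)%N -> t j = s j by move=> /st.
by have := lacunary_sum_lt _ d t s k d0 d4 ts tk (negbT sk); rewrite E ltxx.
Qed.

(** * Neighbourhoods of the squares have density zero *)

(** Squares start at 4, so that consecutive ones are at least 4 apart and all sums stay below
    1/2. *)
Definition spike (j : nat) : nat := (j.+2 ^ 2)%N.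

Lemma spikeS j : spike j.+1 = (spike j + 4 + j.*2.+1)%N.
Proof. by rewrite /spike; lia. Qed.

Definition near_spike (M : nat) : set nat :=
  [set n | exists j, (n < spike j + M)%N /\ (spike j < n + M)%N].

(** The parameter [K] replaces a square root: a relevant [j] is below [K] or satisfies
    [j * K <= j * j <= N + M.+1]. Each spike accounts for at most [M.*2] integers. *)
Lemma count_near_spike (M K N : nat) : (0 < K)%N ->
  (count (fun n => n.+1 \in near_spike M) (iota 1 N) * K <=
   M.*2 * (K * K + K + M.+1) + M.*2 * N)%N.
Proof.
move=> K0; pose J := (K + ((N + M.+1) %/ K).+1)%N.
suff: (count (fun n => n.+1 \in near_spike M) (iota 1 N) <= J * M.*2)%N.
  have : ((N + M.+1) %/ K * K <= N + M.+1)%N by exact: leq_trunc_div.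
  rewrite /J; move: (_ %/ _)%N (count _ _) => u c uK cJ.
  have : (c * K <= (K + u.+1) * M.*2 * K)%N by rewrite leq_mul2r cJ orbT.
  have : (M.*2 * (u * K) <= M.*2 * (N + M.+1))%N by rewrite leq_mul2l uK orbT.
  by nia.
rewrite -size_filter.
pose f j i := (spike j + i - M.+1)%N.
have <- : size [seq f j i | j <- iota 0 J, i <- iota 0 M.*2] = (J * M.*2)%N.
  by rewrite size_allpairs !size_iota.
apply: uniq_leq_size; first by rewrite filter_uniq// iota_uniq.
move=> n; rewrite mem_filter mem_iota => /andP[/set_mem[j [nj jn]] nN].
apply/allpairsP; exists (j, n.+1 + M - spike j)%N; rewrite /= !mem_iota /f.
split; [|lia|lia].
rewrite add0n leq0n /=.
have jN : (j * j <= N + M.+1)%N by move: jn nN; rewrite /spike -mulnn; lia.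
rewrite /J addnS ltnS; have [jK|Kj] := ltnP j K.
  by rewrite (leq_trans (ltnW jK))// leq_addr.
apply: leq_trans _ (leq_addl _ _).
by rewrite leq_divRL//; apply: leq_trans jN; rewrite leq_mul2l Kj orbT.
Qed.

(** The shift [n.+1] matches [cf_denomE]. *)
Lemma near_spike_density (R : realType) (M : nat) :
  has_density [set n | near_spike M n.+1] (0 : R).
Proof.
apply/cvgr0Pnorm_le => e e0.
(* With this [K] the linear term of [count_near_spike] costs at most e/2; the constant term costs
   e/2 once [N] is large. *)
pose K := (Num.bound (4 * M%:R / e)).+1.
have KE : M.*2%:R <= e / 2 * K%:R :> R.
  have eM : 0 <= 4 * M%:R / e by rewrite divr_ge0// ltW.
  have := archi_boundP eM; rewrite ltr_pdivrMr// -muln2 natrM.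
  by rewrite /K -natr1; nra.
pose C : R := (M.*2 * (K * K + K + M.+1))%:R.
near=> N.
have N0 : 0 < N%:R :> R by near: N; exact: nbhs_infty_gtr.
have CN : C <= e / 2 * N%:R.
  rewrite mulrC -ler_pdivrMr ?divr_gt0//; near: N; exact: nbhs_infty_ger.
rewrite /density_upto (@eq_count _ _ (fun n => n.+1 \in near_spike M)); last first.
  by move=> n; apply/idP/idP => /set_mem nn; exact: mem_set.
rewrite ger0_norm ?divr_ge0// ler_pdivrMr//.
have K0 : 1 <= K%:R :> R by rewrite ler1n.
rewrite -(ler_pM2r (lt_le_trans ltr01 K0)).
have /(_ isT) := count_near_spike M K N.
rewrite -(ler_nat R) natrM natrD -/C [(_ * N)%:R]natrM => le1.
apply: le_trans le1 _.
have : M.*2%:R * N%:R <= e / 2 * K%:R * N%:R by rewrite ler_wpM2r// ltW.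
have : e / 2 * N%:R <= e / 2 * N%:R * K%:R.
  by rewrite ler_peMr// mulr_ge0// ?divr_ge0// ltW.
nra.
Unshelve. all: by end_near. Qed.

(** * Points built from errors at the squares *)

Section SparseCombination.
Context {R : realType} (alpha : R).
Context (alpha01 : 0 < alpha < 1).
Context (alpha_irr : irrational alpha).

Let a := cf_digit alpha.
Let Q n : R := (cf_den a n)%:~R.
Local Notation D := (cf_err alpha).

Definition sparse_sum (s : nat -> bool) : R :=
  lacunary_sum (fun j => D (spike j)) s.

Let a_ge1 n : 1 <= a n. Proof. exact: cf_digit_ge1. Qed.
Let D_gt0 n : 0 < D n. Proof. exact: cf_err_gt0. Qed.
Let Q_ge0 n : 0 <= Q n. Proof. by rewrite ler0z cf_den_ge0. Qed.

Lemma spike_gt0 j : 0 < D (spike j). Proof. exact: D_gt0. Qed.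

Lemma cf_err_spike j : D (spike j.+1) <= D (spike j) / 4.
Proof.
rewrite spikeS -addnA; apply: le_trans (cf_err_decay alpha alpha01 alpha_irr _ _) _.
rewrite ler_wpM2l//; first exact: ltW.
have -> : ((4 + j.*2.+1)./2 = j.+2)%N.
  by rewrite addnS -[4%N]/(2.*2)%N -doubleD /= uphalf_double.
have : 2^-1 ^+ j <= 1 :> R by rewrite exprn_ile1// ?invr_ge0// invf_le1// ler1n.
by rewrite !exprS; lra.
Qed.

Lemma sparse_sum_itv s : 0 <= sparse_sum s <= 2^-1.
Proof.
have d2 j : D (spike j.+1) <= D (spike j) / 2.
  by have := cf_err_spike j; have := D_gt0 (spike j); lra.
have /andP[] := lacunary_sum_itv _ s spike_gt0 d2 0; rewrite !big_ord0 add0r.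
move=> lo hi; rewrite lo (le_trans hi)//.
have := cf_err_decay alpha alpha01 alpha_irr 0 4.
by rewrite cf_err0 add0n (_ : spike 0 = 4)//= !exprS expr0; lra.
Qed.

Lemma sparse_sum_inj : injective sparse_sum.
Proof. exact: lacunary_sum_inj spike_gt0 cf_err_spike. Qed.

Lemma cf_den_err_decay M n p : (n + M <= p)%N -> Q n * D p <= 2^-1 ^+ M./2.
Proof.
move=> nMp; have -> : p = (n + (p - n))%N by lia.
apply: (@le_trans _ _ (Q n * (D n * 2^-1 ^+ (p - n)./2))).
  by rewrite ler_wpM2l ?cf_err_decay.
rewrite mulrA -[leRHS]mul1r ler_pM ?mulr_ge0 ?exprn_ge0 ?invr_ge0 ?(ltW (D_gt0 _))//.
  exact: cf_den_err_le1.
by rewrite ler_wiXn2l// ?invr_ge0// ?invf_le1// ?ler1n//; lia.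
Qed.

(** Denominators at least double from one spike to the next, so the last term dominates as in a
    geometric sum. *)
Lemma cf_den_spike k : \sum_(j < k.+1) Q (spike j) <= 2 * Q (spike k).
Proof.
elim: k => [|k IH]; first by rewrite big_ord1; have := Q_ge0 (spike 0); lra.
rewrite big_ord_recr /=; suff : 2 * Q (spike k) <= Q (spike k.+1) by lra.
rewrite /Q -(intrM _ 2) ler_int spikeS.
apply: le_trans (cf_den_double a a_ge1 (spike k)) _.
have -> : (spike k + 4 + k.*2.+1 = (spike k).+2 + k.*2.+3)%N by lia.
move: k.*2.+3 => t; elim: t => [|t IHt]; first by rewrite addn0.
by rewrite addnS (le_trans IHt)// cf_den_leS.
Qed.

(** By [cf_den_err_swap], each [Q n * D (spike j)] is [Q (spike j) * D n] up to sign modulo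
    integers; this is small for spikes well before [n]. *)
Lemma psum_dist_int n (s : nat -> bool) k :
  exists z : int, `|Q n * (\sum_(j < k) (s j)%:R * D (spike j)) - z%:~R|
    <= (\sum_(j < k) Q (spike j)) * D n.
Proof.
elim: k => [|k [z IH]].
  by exists 0; rewrite !big_ord0 mulr0 mul0r subrr normr0.
have [w Ew] := cf_den_err_swap alpha alpha01 alpha_irr n (spike k).
exists (z + (s k)%:R * w); rewrite !big_ord_recr /= mulrDl.
have QD : 0 <= Q (spike k) * D n by rewrite mulr_ge0// ltW.
have -> : forall S : R, Q n * (S + (s k)%:R * D (spike k)) - (z + (s k)%:R * w)%:~R =
    (Q n * S - z%:~R) + (s k)%:R * ((-1) ^+ (n + spike k) * (Q (spike k) * D n)).
  move=> S; rewrite mulrDr mulrCA Ew intrD intrM -/(Q _).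
  by case: (s k); rewrite /=; ring.
apply: le_trans (ler_normD _ _) (lerD IH _).
rewrite normrM normrMsign (ger0_norm QD).
by case: (s k); rewrite ?normr1 ?normr0 ?mul1r ?mul0r.
Qed.

Lemma dist_int_sparse M n s : ~ near_spike M n ->
  dist_int (Q n * sparse_sum s) <= 4 * 2^-1 ^+ M./2.
Proof.
move=> nnear.
have far j : (spike j + M <= n)%N \/ (n + M <= spike j)%N.
  have [|nj] := leqP (spike j + M) n; first by left.
  by right; rewrite leqNgt; apply/negP => jn; apply: nnear; exists j.
(* [k] is the first spike index at or past [n]; as [n] is far from every spike, both sides gain the
   margin [M]. *)
have [k nk k_min] : exists2 k, (n + M <= spike k)%N &
    forall j, (j < k)%N -> (spike j + M <= n)%N.
  have ex : exists k, (n <= spike k)%N by exists n; rewrite /spike -mulnn; nia.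
  exists (ex_minn ex); case: ex_minnP => k nk kmin.
    by have [] := far k; lia.
  move=> j jk; have [//|nj] := far j.
  by have := kmin j; lia.
have d2 j : D (spike j.+1) <= D (spike j) / 2.
  by have := cf_err_spike j; have := D_gt0 (spike j); lra.
have := lacunary_sum_itv _ s spike_gt0 d2 k; rewrite -/(sparse_sum s).
have [z] := psum_dist_int n s k; move: (\sum_(j < k) _ * _) => X zX /andP[lo hi].
apply: le_trans (dist_int_le _ z) _.
have -> : Q n * sparse_sum s - z%:~R = (Q n * X - z%:~R) + Q n * (sparse_sum s - X).
  by ring.
apply: le_trans (ler_normD _ _) _.
have -> : 4 * 2^-1 ^+ M./2 = 2 * 2^-1 ^+ M./2 + 2 * 2^-1 ^+ M./2 :> R by ring.
(* Spikes before [n] are bounded after the swap, and those past [n] directly by the tail of the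
   series. *)
apply: lerD.
  apply: le_trans zX _; case: k k_min {nk lo hi} => [|k] k_min.
    by rewrite big_ord0 mul0r mulr_ge0// exprn_ge0// invr_ge0.
  apply: (@le_trans _ _ (2 * Q (spike k) * D n)).
    by rewrite ler_wpM2r ?cf_den_spike// ltW.
  by rewrite -mulrA ler_wpM2l// cf_den_err_decay// k_min.
rewrite ger0_norm; last by rewrite mulr_ge0// subr_ge0.
apply: (@le_trans _ _ (Q n * (2 * D (spike k)))).
  by rewrite ler_wpM2l// lerBlDl.
by rewrite mulrCA ler_wpM2l// cf_den_err_decay.
Qed.

Definition sparse_point (s : nat -> bool) : circle R :=
  \pi_(circle R)%qT (sparse_sum s).

(** Representatives in [0, 1/2] that differ by an integer are equal. *)
Lemma sparse_point_inj : injective sparse_point.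
Proof.
move=> s t /eqP st; apply: sparse_sum_inj.
have : sparse_sum s - sparse_sum t \is a Num.int by rewrite Quotient.idealrBE.
move=> /intrP[z zE].
have /andP[s0 s1] := sparse_sum_itv s; have /andP[t0 t1] := sparse_sum_itv t.
have z1 : z < 1 by rewrite -(ltr_int R) -zE; lra.
have z2 : -1 < z by rewrite -(ltr_int R) -zE; lra.
have z0 : z = 0 by lia.
by apply/eqP; rewrite -subr_eq0 zE z0.
Qed.

Lemma sparse_point_stat s :
  stat_char_subgroup (cf_denom alpha) (sparse_point s).
Proof.
move=> e e0.
have [M Me] : exists M, 4 * 2^-1 ^+ M./2 < e.
  have e4 : 0 <= 4 / e by rewrite divr_ge0// ltW.
  (* Doubling cancels the halving in the exponent; then [2 ^ b > b > 4 / e] for the bound [b]. *)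
  exists (Num.bound (4 / e)).*2; rewrite doubleK exprVn.
  rewrite ltr_pdivrMr ?exprn_gt0// mulrC -ltr_pdivrMr//.
  by rewrite (lt_trans (archi_boundP e4))// -natrX ltr_nat ltn_expl.
have dM := near_spike_density R M.
apply: (has_density0_sub _ dM dM) => n /= le_e; left; apply: contrapT => far.
have := dist_int_sparse M n.+1 s far; rewrite leNgt => /negP; apply.
apply: lt_le_trans Me (le_trans le_e _).
rewrite /sparse_point -raddfMz circle_norm_pi cf_denomE//.
by rewrite -mulrzl.
Qed.
End SparseCombination.

(** * Uncountability *)

Lemma powerset_nat_no_inj (f : (nat -> bool) -> nat) : ~ injective f.
Proof.
(* Cantor's diagonal: [S] collects the codes of sets that do not contain their own code. *)
move=> f_inj; pose S n := `[< exists2 t, f t = n & ~~ t n >].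
case E: (S (f S)).
  by have /asboolP[t /f_inj ->] := E; rewrite E.
have : S (f S) by apply/asboolP; exists S; rewrite ?E.
by rewrite E.
Qed.

Theorem theoremB (R : realType) (alpha : R)
    (halpha : 0 < alpha < 1) (hirr : irrational alpha) :
  ~ countable (stat_char_subgroup (cf_denom alpha) : set (circle R)).
Proof.
move=> /countable_injP[f f_inj].
apply: (powerset_nat_no_inj (f \o sparse_point alpha)) => s t st.
apply: (sparse_point_inj alpha halpha hirr); apply: f_inj st.
  by apply/mem_set/sparse_point_stat.
by apply/mem_set/sparse_point_stat.
Qed.
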